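(* Let $X$ and $Y$ be complex Banach spaces satisfying the following two properties: (1) every norm closed face of $\mathcal{B}_X$ (respectively, of $\mathcal{B}_Y$) is norm-semi-exposed; (2) every weak$^*$ closed proper face of $\mathcal{B}_{X^*}$ (respectively, of $\mathcal{B}_{Y^*}$) is weak$^*$-semi-exposed. Let $f: S(X)\to S(Y)$ be a surjective isometry. Then the following statements hold: (a) Let $\mathcal{F}$ be a convex set in $S(X)$. Then $\mathcal{F}$ is a norm closed face of $\mathcal{B}_X$ if and only if $f(\mathcal{F})$ is a norm closed face of $\mathcal{B}_Y$. (b) Given $e\in S(X)$, we have $e\in\partial_e(\mathcal{B}_X)$ if and only if $f(e)\in\partial_e(\mathcal{B}_Y)$.
   Context: For a Banach space $X$, $\mathcal{B}_X$ is its closed unit ball, $S(X)$ its unit sphere, $X^*$ its dual, and $\partial_e(C)$ is the set of extreme points of a convex set $C$. For $F\subseteq\mathcal{B}_X$ and $G\subseteq\mathcal{B}_{X^*}$ define $$F'=\{a\in\mathcal{B}_{X^*}: a(x)=1\ \forall x\in F\},\qquad G_{\prime}=\{x\in\mathcal{B}_X: a(x)=1\ \forall a\in G\}.$$ $F$ is a norm-semi-exposed face of $\mathcal{B}_X$ if $F=(F')_{\prime}$; $G$ is a weak$^*$-semi-exposed face of $\mathcal{B}_{X^*}$ if $G=(G_{\prime})'$. An isometry $f:S(X)\to S(Y)$ is a map with $\|f(x)-f(y)\|=\|x-y\|$ for all $x,y\in S(X)$. *)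

(* Defs.v *)
From HB Require Import structures.
From mathcomp Require Import all_boot all_order all_algebra.
From mathcomp Require Import all_classical all_reals all_analysis.
From mathcomp Require Import complex.

Set Implicit Arguments.
Unset Strict Implicit.
Unset Printing Implicit Defensive.

Import Order.TTheory GRing.Theory Num.Theory.
Import numFieldNormedType.Exports.

Local Open Scope classical_set_scope.
Local Open Scope ring_scope.
Local Open Scope convex_scope.

Section convexity.
Context {K : numDomainType} {V : lmodType K}.
Local Notation E := (convex_lmodType V).
Implicit Types (C F : set V).

(* When [K] is complex, [t : {i01 K}] means [0 <= t <= 1] for the partial order
   of [K]; such a [t] is real, so this is convexity over the reals.
   The empty set counts as a face. *)
Definition is_face C F : Prop :=
  [/\ F `<=` C,
      @convex_set K V F
    & forall (x y : E) (t : {i01 K}), 0 < t%:num -> t%:num < 1 ->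
        C x -> C y -> F (x <| t |> y) -> F x /\ F y].

Definition extreme_points C : set V :=
  [set e | C e /\
    forall (x y : E) (t : {i01 K}), 0 < t%:num -> t%:num < 1 ->
      C x -> C y -> e = x <| t |> y -> x = e /\ y = e].

End convexity.

Definition unit_ball {K : numDomainType} (X : normedModType K) : set X :=
  [set x | `|x| <= 1].

Definition unit_sphere {K : numDomainType} (X : normedModType K) : set X :=
  [set x | `|x| = 1].

Arguments unit_ball {K} X.
Arguments unit_sphere {K} X.

Section dual_space.
Context {R : realType} (X : normedModType R[i]).

Definition continuous_linear : {pred X -> R[i]^o} :=
  mem [set a : X -> R[i]^o | linear a /\ continuous a].

Record dual := Dual {
  dual_fun :> X -> R[i]^o;
  dual_funP : dual_fun \in continuous_linear }.

HB.instance Definition _ := [isSub for dual_fun].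
HB.instance Definition _ := [Choice of dual by <:].

Lemma continuous_linear_submod_closed : submod_closed continuous_linear.
Proof.
split=> [|k a b]; first by rewrite inE; split=> [c x y|]; [
  by rewrite /= scaler0 addr0 | exact: cst_continuous].
move=> /set_mem[la ca] /set_mem[lb cb]; rewrite inE; split=> [c x y|x].
  rewrite !fctE la lb !scalerDr !scalerA (mulrC k c) -!addrA; congr +%R.
  by rewrite addrCA.
by apply: continuousD; [apply: continuousZl_tmp; exact: ca|exact: cb].
Qed.

HB.instance Definition _ :=
  GRing.isSubmodClosed.Build _ _ continuous_linear
    continuous_linear_submod_closed.
HB.instance Definition _ := [SubChoice_isSubLmodule of dual by <:].

(* The operator norm; it is real-valued because the library norm of [R[i]]
   takes its values in [R[i]]. *)
Definition dual_norm (a : dual) : R :=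
  sup [set complex.Re `|a x| | x in unit_ball X].

Definition dual_unit_ball : set dual := [set a | dual_norm a <= 1].

(* The initial topology for the evaluations [a |-> a x], [x : X]. *)
Definition weak_star : Type :=
  initial_topology (dual_fun : dual -> {ptws X -> R[i]^o}).

HB.instance Definition _ := Topological.on weak_star.

End dual_space.

Arguments dual_unit_ball {R} X.
Arguments weak_star {R} X.
Arguments dual_norm {R X} a.

Section faces.
Context {R : realType} {X : normedModType R[i]}.
Implicit Types (F : set X) (G : set (dual X)).

Definition upper_prime F : set (dual X) :=
  [set a : dual X | dual_unit_ball X a /\ forall x, F x -> a x = 1].

Definition lower_prime G : set X :=
  [set x | unit_ball X x /\ forall a, G a -> a x = 1].

Definition norm_semi_exposed F : Prop := F = lower_prime (upper_prime F).

Definition weak_star_semi_exposed G : Prop := G = upper_prime (lower_prime G).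

Definition norm_closed_face F : Prop := closed F /\ is_face (unit_ball X) F.

Definition weak_star_closed_proper_face G : Prop :=
  [/\ closed (G : set (weak_star X)),
      is_face (dual_unit_ball X) G
    & G <> dual_unit_ball X].

End faces.

Definition closed_faces_semi_exposed {R : realType} (X : normedModType R[i]) :=
  forall F : set X, norm_closed_face F -> norm_semi_exposed F.

Definition weak_star_closed_proper_faces_semi_exposed
    {R : realType} (X : normedModType R[i]) :=
  forall G : set (dual X),
    weak_star_closed_proper_face G -> weak_star_semi_exposed G.

(* [f] stands for a map between the unit spheres; its values off the unit sphere
   are unconstrained. *)
Definition surjective_sphere_isometry {K : numDomainType}
    (X Y : normedModType K) (f : X -> Y) : Prop :=
  [/\ set_fun (unit_sphere X) (unit_sphere Y) f,
      set_surj (unit_sphere X) (unit_sphere Y) f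
    & forall x y, unit_sphere X x -> unit_sphere X y ->
        `|f x - f y| = `|x - y|].

(* Main.v *)
(* Write [star x] for the set of unit vectors [y] with [`|x + y| = 2], and call
   facet a maximal convex subset of the unit sphere. Since [`|x + y|] is the
   distance from [x] to [- y], a surjective isometry [f] of spheres and its
   conjugate [g x = - f (- x)] satisfy [`|f x + g y| = `|x + y|]; this pairing
   forces [f @` M] to be a facet whenever [M] is one.
   It remains to see that a closed face [F] in the sphere is an intersection of
   facets. If [x] is a unit vector outside [F], the functionals of [upper_prime F]
   whose real part is smallest at [x] form a nonempty weak* closed face, hence a
   semi-exposed one; a facet containing its lower prime contains [F] but not [x].
   The minimum is attained by the Hahn-Banach theorem, applied to the largest
   sublinear functional below the norm that bounds all of [upper_prime F]. *)

Require Import Defs.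
From HB Require Import structures.
From mathcomp Require Import all_boot all_order all_algebra.
From mathcomp Require Import all_classical all_reals all_analysis.
From mathcomp Require Import complex.
From mathcomp Require Import ring.

Set Implicit Arguments.
Unset Strict Implicit.
Unset Printing Implicit Defensive.

Import Order.TTheory GRing.Theory Num.Theory.
Import numFieldNormedType.Exports.

Local Open Scope classical_set_scope.
Local Open Scope ring_scope.

(** * Convex combinations and faces *)

Section convex_combinations.
Context {K : numDomainType} {V : lmodType K}.
Implicit Types (C F : set V) (x y : V) (a b : K).

Lemma convex_setE C : @convex_set K V C <->
  forall x y a b, 0 <= a -> 0 <= b -> a + b = 1 -> C x -> C y ->
    C (a *: x + b *: y).
Proof.
split=> [cC x y a b a0 b0 ab Cx Cy|cC x y t xC yC]; last first.
  move: xC yC; rewrite !inE => Cx Cy; apply: (cC x y t%:num (1 - t%:num)) => //.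
  by rewrite addrC subrK.
have a1 : a <= 1 by rewrite -ab lerDl.
have bE : b = 1 - a by rewrite -ab addrAC subrr add0r.
have := cC x y (Itv01 a0 a1).
by rewrite !inE bE; apply.
Qed.

(** Exchanging the endpoints together with their weights reduces the two conclusions of a face to
    one. *)
Lemma is_faceE C F : F `<=` C -> @convex_set K V F ->
  (forall x y a b, 0 < a -> 0 < b -> a + b = 1 -> C x -> C y ->
    F (a *: x + b *: y) -> F x) -> is_face C F.
Proof.
move=> FC cF FF; split=> // x y t t0 t1 Cx Cy Fxy; split.
  apply: (FF x y _ _ t0 _ _ Cx Cy Fxy); rewrite ?subr_gt0//.
  by rewrite addrC subrK.
apply: (FF y x (1 - t%:num) t%:num _ t0 _ Cy Cx); rewrite ?subr_gt0 ?subrK//.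
by rewrite addrC; exact: Fxy.
Qed.

Lemma convex_bigcap (I : Type) (D : set I) (G : I -> set V) :
  (forall i, D i -> @convex_set K V (G i)) ->
  @convex_set K V (\bigcap_(i in D) G i).
Proof.
move=> cG; apply/convex_setE => x y a b a0 b0 ab Gx Gy i Di.
by move/convex_setE : (cG i Di); apply=> //; [exact: Gx|exact: Gy].
Qed.

Lemma is_face_bigcap (I : Type) (D : set I) (G : I -> set V) C : D !=set0 ->
  (forall i, D i -> is_face C (G i)) -> is_face C (\bigcap_(i in D) G i).
Proof.
move=> [i0 Di0] fG; split.
- by move=> x Gx; have [GC _ _] := fG _ Di0; exact/GC/Gx.
- by apply: convex_bigcap => i Di; have [] := fG _ Di.
- move=> x y t t0 t1 Cx Cy Gxy; split=> i Di; have [_ _ fGi] := fG _ Di;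
    by have [] := fGi x y t t0 t1 Cx Cy (Gxy i Di).
Qed.

Lemma convex_set1 x : @convex_set K V [set x].
Proof.
by apply/convex_setE => _ _ a b _ _ ab -> ->; rewrite /= -scalerDl ab scale1r.
Qed.

Lemma extreme_pointsE C e : extreme_points C e <-> is_face C [set e].
Proof.
split=> [[Ce eC]|[/(_ e erefl) Ce _ fe]].
  split=> [_ ->//| |x y t t0 t1 Cx Cy /= xy]; first exact: convex_set1.
  exact: (eC x y t).
by split=> // x y t t0 t1 Cx Cy exy; exact: (fe x y t).
Qed.

End convex_combinations.

Section convex_join.
Context {K : numFieldType} {V : lmodType K}.
Implicit Types (C : set V) (x y : V) (a b : K).

(** Dividing by [a + b] gives weights of sum 1; if [a + b = 0], both weights vanish and any point of
    [C] serves. *)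
Lemma convex_cone C x y a b : @convex_set K V C -> 0 <= a -> 0 <= b ->
  C x -> C y -> exists2 z, C z & a *: x + b *: y = (a + b) *: z.
Proof.
move=> /convex_setE cC a0 b0 Cx Cy.
have [ab0|ab0] := eqVneq (a + b) 0.
  move: ab0 => /eqP; rewrite paddr_eq0// => /andP[/eqP-> /eqP->].
  by exists x => //; rewrite addr0 !scale0r addr0.
have ab_ge0 : 0 <= (a + b)^-1 by rewrite invr_ge0 addr_ge0.
exists ((a / (a + b)) *: x + (b / (a + b)) *: y).
  by apply: cC; rewrite ?mulr_ge0// -mulrDl divff.
by rewrite scalerDr !scalerA ![(a + b) * _]mulrC !divfK.
Qed.

(** For nonempty convex [C] this is the convex hull of [x] and [C]. *)
Definition cone_over x C : set V :=
  [set z | exists a b y, [/\ 0 <= a, 0 <= b, a + b = 1, C y &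
    z = a *: x + b *: y]].

Lemma convex_cone_over x C :
  @convex_set K V C -> @convex_set K V (cone_over x C).
Proof.
move=> cC; apply/convex_setE => _ _ s t s0 t0 st
  [a1 [b1 [y1 [a10 b10 ab1 Cy1 ->]]]] [a2 [b2 [y2 [a20 b20 ab2 Cy2 ->]]]].
have [y Cy yE] := convex_cone cC (mulr_ge0 s0 b10) (mulr_ge0 t0 b20) Cy1 Cy2.
exists (s * a1 + t * a2), (s * b1 + t * b2), y; split=> //.
- by rewrite addr_ge0 ?mulr_ge0.
- by rewrite addr_ge0 ?mulr_ge0.
- by rewrite addrACA -!mulrDr ab1 ab2 !mulr1 st.
- by rewrite !scalerDr !scalerA addrACA yE -scalerDl.
Qed.

End convex_join.

(** * Maximal convex subsets of the unit sphere *)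

Section sphere_geometry.
Context {K : numFieldType} {X : normedModType K}.
Implicit Types (C M : set X) (x y z : X) (a b : K).

Lemma norm_convex_le x y a b : 0 <= a -> 0 <= b ->
  `|a *: x + b *: y| <= a * `|x| + b * `|y|.
Proof.
by move=> a0 b0; rewrite (le_trans (ler_normD _ _))// !normrZ !ger0_norm.
Qed.

(** The gaps [m - u] and [m - v] are nonnegative and their weighted sum is at most 0, so the gap of
    positive weight vanishes. *)
Lemma convex_comb_eq_max (u v m a b : K) : 0 < a -> 0 <= b -> a + b = 1 ->
  u <= m -> v <= m -> m <= a * u + b * v -> u = m.
Proof.
move=> a0 b0 ab um vm h; apply/eqP; rewrite eq_le um/=.
rewrite -subr_le0 -(pmulr_rle0 _ a0).
have -> : a * (m - u) = m - (a * u + b * v) - b * (m - v).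
  by rewrite (_ : b = 1 - a); [ring|rewrite -ab addrAC subrr add0r].
rewrite subr_le0; apply: (@le_trans _ _ 0); first by rewrite subr_le0.
by rewrite mulr_ge0// subr_ge0.
Qed.

(** The points with weights [a, b] and [b, a] add up to [x + y], of norm 2, and neither has norm
    above 1, so both have norm exactly 1. *)
Lemma sphere_segment x y a b : `|x| = 1 -> `|y| = 1 -> `|x + y| = 2 ->
  0 <= a -> 0 <= b -> a + b = 1 -> `|a *: x + b *: y| = 1.
Proof.
move=> x1 y1 xy2 a0 b0 ab.
have le1 c d : 0 <= c -> 0 <= d -> c + d = 1 -> `|c *: x + d *: y| <= 1.
  by move=> c0 d0 cd; rewrite (le_trans (norm_convex_le _ _ _ _))// x1 y1
    !mulr1 cd.
apply/eqP; rewrite eq_le le1//= -(lerD2r 1) -[1 + 1]/2 -xy2.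
have -> : x + y = (a *: x + b *: y) + (b *: x + a *: y).
  by rewrite addrACA -!scalerDl (addrC b) ab !scale1r.
by rewrite (le_trans (ler_normD _ _))// lerD2l le1// addrC.
Qed.

Lemma convex_sphere_normD C x y : C `<=` unit_sphere X -> @convex_set K X C ->
  C x -> C y -> `|x + y| = 2.
Proof.
move=> CS /convex_setE cC Cx Cy.
have half : 2^-1 + 2^-1 = 1 :> K by rewrite [RHS](splitr 1) mul1r.
have xy1 : `|2^-1 *: x + 2^-1 *: y| = 1 by apply/CS/cC; rewrite ?invr_ge0.
have -> : x + y = 2 *: (2^-1 *: x + 2^-1 *: y).
  by rewrite scalerDr !scalerA divff// !scale1r.
by rewrite normrZ xy1 mulr1 ger0_norm.
Qed.

(** The vector is a convex combination of [x + z] and [y + z], whose norms are at most 2, so that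
    bound is attained at [x + z]. *)
Lemma normD_face x y z a b : 0 < a -> 0 <= b -> a + b = 1 ->
  `|x| <= 1 -> `|y| <= 1 -> `|z| <= 1 ->
  `|a *: x + b *: y + z| = 2 -> `|x + z| = 2.
Proof.
move=> a0 b0 ab x1 y1 z1 h.
have le2 v : `|v| <= 1 -> `|v + z| <= 2.
  move=> v1; rewrite (le_trans (ler_normD _ _))//.
  by rewrite [leRHS](_ : 2 = 1 + 1)// lerD.
apply: (convex_comb_eq_max a0 b0 ab (le2 _ x1) (le2 _ y1)).
rewrite -h; have -> : a *: x + b *: y + z = a *: (x + z) + b *: (y + z).
  by rewrite !scalerDr addrACA -scalerDl ab scale1r.
by rewrite norm_convex_le// ltW.
Qed.

Definition star x : set X := [set y | `|y| = 1 /\ `|x + y| = 2].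

Definition facet M : Prop := [/\ M `<=` unit_sphere X, @convex_set K X M
  & forall C, C `<=` unit_sphere X -> @convex_set K X C -> M `<=` C -> C `<=` M].

Lemma exists_facet C : C `<=` unit_sphere X -> @convex_set K X C ->
  exists2 M, facet M & C `<=` M.
Proof.
move=> CS cC.
(* Convexity is asked of the union with [C], instead of asking that [D] contain [C], so that the
   union of the empty chain qualifies. *)
pose P : set (set X) :=
  fun D => D `<=` unit_sphere X /\ @convex_set K X (C `|` D).
have [|M [[MS cM] maxM]] := @Zorn_bigcup X P.
  move=> F FP Ftot; split=> [x [D FD Dx]|]; first exact: (FP _ FD).1.
  have [F0|/set0P[D0 FD0]] := eqVneq F set0.
    by rewrite F0 bigcup_set0 setU0.
  have joint x y : (C `|` \bigcup_(D in F) D) x ->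
      (C `|` \bigcup_(D in F) D) y ->
      exists D, [/\ F D, (C `|` D) x & (C `|` D) y].
    move=> [Cx|[D1 FD1 D1x]] [Cy|[D2 FD2 D2y]].
    - by exists D0; split=> //; left.
    - by exists D2; split=> //; [left|right].
    - by exists D1; split=> //; [right|left].
    - have [D12|D21] := Ftot _ _ FD1 FD2.
        by exists D2; split=> //; right=> //; exact: D12.
      by exists D1; split=> //; right=> //; exact: D21.
  apply/convex_setE => x y a b a0 b0 ab Fx Fy.
  have [D [FD Dx Dy]] := joint _ _ Fx Fy.
  have /convex_setE cD := (FP _ FD).2.
  by have [|Dxy] := cD _ _ _ _ a0 b0 ab Dx Dy; [left|right; exists D].
exists (C `|` M); last by left.
split=> // [x [/CS//|/MS//]|D DS cD CMD x Dx].
right; apply: contrapT => Mx; apply: (maxM D).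
  split; first by apply: subset_trans CMD; exact: subsetUr.
  by move=> /(_ x Dx).
split=> //; rewrite (_ : C `|` D = D)//; apply/seteqP; split=> y; last by right.
by case=> // Cy; apply: CMD; left.
Qed.

(** The cone over [M] with apex [x] stays in the sphere, so maximality puts [x] in [M]. For empty
    [M] that cone is empty, and [[set x]] replaces it. *)
Lemma facet_star M x : facet M -> `|x| = 1 -> (forall y, M y -> `|x + y| = 2) ->
  M x.
Proof.
move=> [MS cM maxM] x1 xM.
have [M0|/set0P[y0 My0]] := eqVneq M set0.
  have := maxM [set x]; rewrite {1}M0; apply=> //; last exact: convex_set1.
  by move=> _ ->.
apply: (maxM (cone_over x M)); last 1 first.
- by exists 1, 0, y0; rewrite scale1r scale0r !addr0.
- move=> _ [a [b [y [a0 b0 ab My ->]]]].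
  exact: sphere_segment x1 (MS _ My) (xM _ My) a0 b0 ab.
- exact: convex_cone_over.
- by move=> y My; exists 0, 1, y; rewrite scale1r scale0r !add0r.
Qed.

Lemma facetE M : facet M ->
  M = unit_sphere X `&` \bigcap_(y in M) [set x | `|x + y| = 2].
Proof.
move=> fM; have [MS cM _] := fM; apply/seteqP; split=> [x Mx|x [x1 xM]].
  by split=> [|y My]; [exact: MS|exact: convex_sphere_normD MS cM Mx My].
exact: facet_star.
Qed.

Lemma facet_closed M : facet M -> closed M.
Proof.
move=> fM; rewrite (facetE fM).
have closed_norm (v : X) (k : K) : closed [set x : X | `|x + v| = k].
  rewrite (_ : mkset _ = (fun x : X => `|x + v| : K^o) @^-1` [set k])//.
  apply: closed_comp => [x _|]; last first.
    exact: (accessible_closed_set1 (hausdorff_accessible _)).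
  apply: (@continuous_comp _ _ _ (fun x : X => x + v) (fun x : X => `|x| : K^o)).
    by apply: continuousD; [exact: id|exact: cst_continuous].
  exact: norm_continuous.
apply: closedI; last by apply: closed_bigI => v _; exact: closed_norm.
by have := closed_norm 0 1; under eq_set do rewrite addr0.
Qed.

(** A point of [M] inside the segment attains the bound 1 on the norm and the bound 2 on the norm of
    its sum with any [z] in [M]. The endpoints then attain both, and [facet_star] applies. *)
Lemma facet_face M : facet M -> is_face (unit_ball X) M.
Proof.
move=> fM; have [MS cM _] := fM.
have norm_le1 x : M x -> `|x| <= 1 by move=> /MS ->.
apply: is_faceE => // x y a b a0 b0 ab x1 y1 Mxy.
apply: facet_star => // [|z Mz].
  apply/eqP; rewrite eq_le x1/=.
  rewrite (@convex_comb_eq_max `|x| `|y| 1 a b)//; first exact: ltW.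
  by rewrite -(MS _ Mxy) norm_convex_le// ltW.
apply: (normD_face a0 (ltW b0) ab x1 y1 (norm_le1 _ Mz)).
exact: convex_sphere_normD MS cM Mxy Mz.
Qed.

Lemma exists_facet2 x y : `|x| = 1 -> `|y| = 1 -> `|x + y| = 2 ->
  exists M, [/\ facet M, M x & M y].
Proof.
move=> x1 y1 xy2; have [| |M fM xyM] := @exists_facet (cone_over x [set y]).
- by move=> _ [a [b [z [a0 b0 ab -> ->]]]]; exact: sphere_segment.
- by apply: convex_cone_over; exact: convex_set1.
- exists M; split=> //; apply: xyM.
    by exists 1, 0, y; rewrite scale1r scale0r !addr0.
  by exists 0, 1, y; rewrite scale1r scale0r !add0r.
Qed.

(** Given [w] in [star v], take a facet through [v] and [w]. Its points lie in [star v], hence in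
    [star x] and [star y], so by [facet_star] it contains [x], [y] and their segment. *)
Lemma star_convex v x y a b : `|v| = 1 -> `|x| = 1 -> `|y| = 1 ->
  star v `<=` star x -> star v `<=` star y -> 0 <= a -> 0 <= b -> a + b = 1 ->
  `|a *: x + b *: y| = 1 /\ star v `<=` star (a *: x + b *: y).
Proof.
move=> v1 x1 y1 vx vy a0 b0 ab.
have key w : star v w -> exists M, [/\ facet M, M w & M (a *: x + b *: y)].
  move=> [w1 vw2]; have [M [fM Mv Mw]] := exists_facet2 v1 w1 vw2.
  have [MS cM _] := fM; exists M; split=> //.
  have Mstar z : `|z| = 1 -> star v `<=` star z -> M z.
    move=> z1 vz; apply: facet_star => // m Mm.
    have [] // : star z m; apply: vz; split; first exact: MS.
    exact: convex_sphere_normD MS cM Mv Mm.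
  by move/convex_setE : cM; apply=> //; exact: Mstar.
(* Since [v] lies in [star v], [key] applies to [w = v] and puts the combination in a facet. *)
have xy1 : `|a *: x + b *: y| = 1.
  have [|M [[MS _ _] _ /MS//]] := key v; split=> //.
  by rewrite -mulr2n normrMn v1.
split=> // w vw; have [M [[MS cM _] Mw Mxy]] := key w vw.
by split; [exact: MS|exact: convex_sphere_normD MS cM Mxy Mw].
Qed.

End sphere_geometry.

(* In a finite-dimensional space a facet is [star x] for a suitable [x]; here the
   directed family of the sets [star x], [x] in the facet, replaces it. *)
Lemma facet_pairing {K : numFieldType} {X Y : normedModType K} (f g : X -> Y)
    (M : set X) :
  (forall x, `|x| = 1 -> `|f x| = 1) -> (forall x, `|x| = 1 -> `|g x| = 1) ->
  (forall y, `|y| = 1 -> exists2 x, `|x| = 1 & f x = y) ->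
  (forall x y, `|x| = 1 -> `|y| = 1 -> `|f x + g y| = `|x + y|) ->
  facet M -> exists D, [/\ facet D, g @` M `<=` D & D `<=` f @` M].
Proof.
move=> f1 g1 f_surj fgD fM; have [MS cM _] := fM.
(* By the pairing and the surjectivity of [f], [star (g x)] is the image of [star x] under [f]. *)
have star_g x y : `|x| = 1 -> `|y| = 1 ->
    star x `<=` star y -> star (g x) `<=` star (g y).
  move=> x1 y1 xy w [w1]; have [z z1 <-] := f_surj _ w1.
  rewrite addrC fgD// addrC => xz.
  have [_ yz] : star y z by exact: xy.
  by split; rewrite ?f1// addrC fgD// addrC.
(* For fixed [y] the condition on [z] is convex by [star_convex]. The union over [M] stays convex
   because the star of the midpoint of two points of [M] lies in the stars of both. *)
pose U := [set z | `|z| = 1 /\ exists2 y, M y & star (g y) `<=` star z].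
have [||D fD UD] := @exists_facet _ _ U; first by move=> z [].
- apply/convex_setE => z1 z2 a b a0 b0 ab [z11 [y1 My1 yz1]] [z21 [y2 My2 yz2]].
  have half : 2^-1 + 2^-1 = 1 :> K by rewrite [RHS](splitr 1) mul1r.
  have half0 : 0 < 2^-1 :> K by rewrite invr_gt0.
  have My : M (2^-1 *: y1 + 2^-1 *: y2).
    by move/convex_setE : cM; apply=> //; exact: ltW.
  have le1 x : M x -> `|x| <= 1 by move=> /MS ->.
  have sub1 : star (2^-1 *: y1 + 2^-1 *: y2) `<=` star y1.
    move=> w [w1 yw]; split=> //; apply: normD_face half0 (ltW half0) half _ _ _ yw;
      by rewrite ?w1// le1.
  have sub2 : star (2^-1 *: y1 + 2^-1 *: y2) `<=` star y2.
    move=> w [w1]; rewrite [X in X + w]addrC => yw; split=> //.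
    apply: normD_face half0 (ltW half0) half _ _ _ yw; by rewrite ?w1// le1.
  have [] := @star_convex _ _ (g (2^-1 *: y1 + 2^-1 *: y2)) z1 z2 a b => //.
  - exact/g1/MS.
  - by apply: subset_trans yz1; apply: star_g => //; exact: MS.
  - by apply: subset_trans yz2; apply: star_g => //; exact: MS.
  by split=> //; exists (2^-1 *: y1 + 2^-1 *: y2).
- exists D; split=> //.
    by move=> _ [y My <-]; apply: UD; split; [exact/g1/MS|exists y].
  (* The point [d = f x] and every [g y] lie in the convex set [D], so [f x + g y], and with it
     [x + y], has norm 2. *)
  move=> d Dd; have [DS cD _] := fD; have [x x1 xd] := f_surj d (DS _ Dd).
  exists x => //; apply: facet_star => // y My; rewrite -fgD//; last exact: MS.
  rewrite xd; apply: convex_sphere_normD DS cD Dd _.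
  by apply: UD; split; [exact/g1/MS|exists y].
Qed.

(** * Surjective isometries of unit spheres *)

Section sphere_isometry.
Context {K : numFieldType} {X Y : normedModType K} (f : X -> Y).
Hypothesis f_iso : surjective_sphere_isometry f.

Let f1 x : `|x| = 1 -> `|f x| = 1.
Proof. by case: f_iso => fS _ _ /fS. Qed.

Let f_surj y : `|y| = 1 -> exists2 x, `|x| = 1 & f x = y.
Proof. by case: f_iso => _ fS _ /fS[x x1 xy]; exists x. Qed.

Let f_dist x y : `|x| = 1 -> `|y| = 1 -> `|f x - f y| = `|x - y|.
Proof. by case: f_iso => _ _; apply. Qed.

Lemma sphere_isometry_inj x y : `|x| = 1 -> `|y| = 1 -> f x = f y -> x = y.
Proof.
move=> x1 y1 fxy; apply/eqP; rewrite -subr_eq0 -normr_eq0 -f_dist// fxy subrr.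
by rewrite normr0.
Qed.

Lemma sphere_isometry_inv : exists g : Y -> X,
  surjective_sphere_isometry g /\ forall x, `|x| = 1 -> g (f x) = x.
Proof.
have /choice[g gP] : forall y, exists x, `|y| = 1 -> `|x| = 1 /\ f x = y.
  (* Off the sphere the inverse takes the default value 0. *)
  move=> y; have [y1|y1] := pselect (`|y| = 1); last by exists 0.
  by have [x x1 xy] := f_surj y1; exists x.
have gf x : `|x| = 1 -> g (f x) = x.
  by move=> x1; have [g1 fg] := gP _ (f1 x1); exact: sphere_isometry_inj.
exists g; split=> //; split=> [y /gP[]//|x x1|x y /gP[gx fgx] /gP[gy fgy]].
  by exists (f x); [exact: f1|exact: gf].
by rewrite -f_dist// fgx fgy.
Qed.

(** Pairing [f] with [g] squeezes a facet [D] between the images of [M] under [g] and [f];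
    exchanging the roles gives the opposite inclusion of these images, so all three sets
    coincide. *)
Lemma sphere_isometry_facet M : facet M -> facet (f @` M).
Proof.
move=> fM; pose g x := - f (- x).
have N1 (x : X) : `|x| = 1 -> `|- x| = 1 by rewrite normrN.
have g1 x : `|x| = 1 -> `|g x| = 1 by move=> x1; rewrite normrN f1// N1.
have g_surj y : `|y| = 1 -> exists2 x, `|x| = 1 & g x = y.
  rewrite -normrN => /f_surj[x x1 xy]; exists (- x); first exact: N1.
  by rewrite /g opprK xy opprK.
have fgD x y : `|x| = 1 -> `|y| = 1 -> `|f x + g y| = `|x + y|.
  by move=> x1 y1; rewrite f_dist// ?N1// opprK.
have gfD x y : `|x| = 1 -> `|y| = 1 -> `|g x + f y| = `|x + y|.
  by move=> x1 y1; rewrite addrC fgD// addrC.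
have [D [fD gD Df]] := facet_pairing f1 g1 f_surj fgD fM.
have [E [_ fE Eg]] := facet_pairing g1 f1 g_surj gfD fM.
suff -> : f @` M = D by [].
apply/seteqP; split=> //; apply: subset_trans gD.
exact: subset_trans fE Eg.
Qed.

End sphere_isometry.

(** * Sublinear functionals *)

Section hahn_banach.
Context {R : realType} {E : lmodType R}.
Implicit Types (p q h : E -> R) (D : set E) (x y u v : E).

(** The scaling inequality amounts to positive homogeneity, by applying it to the inverse scalar as
    in [sublinearZ]. *)
Definition sublinear p : Prop := (forall x y, p (x + y) <= p x + p y) /\
  (forall r x, 0 <= r -> p (r *: x) <= r * p x).

Lemma sublinear0 p : sublinear p -> p 0 = 0.
Proof.
move=> [pD pZ]; apply/eqP; rewrite eq_le.
have := pZ 0 0 (lexx 0); rewrite scale0r mul0r => ->/=.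
by have := pD 0 0; rewrite addr0 lerDl.
Qed.

Lemma sublinearZ p r x : sublinear p -> 0 <= r -> p (r *: x) = r * p x.
Proof.
move=> sp; rewrite le_eqVlt => /predU1P[<-|r0].
  by rewrite scale0r mul0r sublinear0.
have [_ pZ] := sp; apply/eqP; rewrite eq_le pZ ?(ltW r0)//=.
rewrite mulrC -ler_pdivlMr// mulrC.
have := pZ r^-1 (r *: x); rewrite scalerA mulVf ?gt_eqF// scale1r; apply.
by rewrite invr_ge0 ltW.
Qed.

Lemma sublinear_ge p x : sublinear p -> - p (- x) <= p x.
Proof.
move=> sp; rewrite -subr_ge0 opprK; have := sp.1 x (- x).
by rewrite subrr sublinear0.
Qed.

Lemma scalarD h x y : scalar h -> h (x + y) = h x + h y.
Proof. by move=> hL; have := hL 1 x y; rewrite scale1r mul1r. Qed.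

Lemma scalar_scale h r x : scalar h -> h (r *: x) = r * h x.
Proof.
move=> hL; have h0 : h 0 = 0.
  by apply: (addIr (h 0)); rewrite -scalarD// !add0r.
by have := hL r x 0; rewrite h0 !addr0.
Qed.

(* [p w] is the infimum of [q (w + l *: u) - l * c], [l >= 0] and [u] in [D]. *)
Lemma sublinear_restrict q D c : sublinear q -> D !=set0 -> @convex_set R E D ->
  (forall u, D u -> c <= q u) ->
  exists p, [/\ sublinear p, forall x, p x <= q x,
    forall u, D u -> p (- u) <= - c &
    forall h, scalar h -> (forall x, h x <= q x) -> (forall u, D u -> c <= h u) ->
      forall x, h x <= p x].
Proof.
move=> sq [u0 Du0] cD cq; have [qD _] := sq.
pose S w : set R :=
  [set z | exists l u, [/\ 0 <= l, D u & z = q (w + l *: u) - l * c]].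
have S0 w : S w !=set0 by exists (q (w + 0 *: u0) - 0 * c), 0, u0.
have lbS w : has_lbound (S w).
  (* Here [l * c <= q (l *: u) <= q (w + l *: u) + q (- w)]. *)
  exists (- q (- w)) => _ [l [u [l0 Du ->]]].
  rewrite lerBrDl lerBlDr (le_trans (y := q (l *: u)))//.
    by rewrite sublinearZ// ler_wpM2l// cq.
  by rewrite (le_trans _ (qD _ _))// addrAC subrr add0r.
pose p w := inf (S w).
have p_le w l u : 0 <= l -> D u -> p w <= q (w + l *: u) - l * c.
  by move=> l0 Du; apply: ge_inf => //; exists l, u.
have le_p w z :
    (forall l u, 0 <= l -> D u -> z <= q (w + l *: u) - l * c) -> z <= p w.
  by move=> zP; apply: lb_le_inf => // _ [l [u [l0 Du ->]]]; exact: zP.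
have pq x : p x <= q x.
  by have := p_le x 0 u0 (lexx 0) Du0; rewrite scale0r mul0r addr0 subr0.
exists p; split=> //; last 2 first.
- move=> u Du; have := p_le (- u) 1 u ler01 Du.
  by rewrite scale1r mul1r addNr sublinear0// add0r.
- move=> h hL hq hc x; apply: (le_p) => l u l0 Du.
  have -> : h x = h (x + l *: u) - l * h u.
    by rewrite scalarD// scalar_scale// addrK.
  by rewrite lerB// ler_wpM2l// hc.
split=> [x y|r x].
  rewrite -lerBlDr; apply: (le_p) => l u l0 Du.
  rewrite lerBlDr [leRHS]addrC -lerBlDr.
  apply: (le_p) => m v m0 Dv; rewrite lerBlDr.
  (* Convexity of [D] merges the two shifts into the single shift [(l + m) *: w]. *)
  have [w Dw wE] := convex_cone cD l0 m0 Du Dv.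
  apply: (le_trans (p_le _ _ w (addr_ge0 l0 m0) Dw)).
  rewrite -wE addrACA mulrDl opprD [leRHS]addrC [leRHS]addrACA lerD2r.
  exact: qD.
rewrite le_eqVlt => /predU1P[<-|r0].
  by rewrite scale0r mul0r (le_trans (pq _))// sublinear0.
rewrite mulrC -ler_pdivrMr//; apply: (le_p) => l u l0 Du.
rewrite ler_pdivrMr// mulrC (le_trans (p_le _ (r * l) u _ Du))//.
  by rewrite mulr_ge0// ltW.
by rewrite -scalerA -scalerDr sublinearZ ?(ltW r0)// mulrBr mulrA.
Qed.

Lemma minimal_sublinear p : sublinear p -> exists q, [/\ sublinear q,
  forall x, q x <= p x &
  forall q', sublinear q' -> (forall x, q' x <= q x) -> q' = q].
Proof.
move=> sp; pose T := {q | sublinear q /\ forall x, q x <= p x}.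
(* The order is reversed, so a maximal element for Zorn's lemma is a minimal functional. *)
pose Rel (s t : T) := `[< forall x, sval t x <= sval s x >].
have [||||[q [sq qp]] qmin] := @Zorn T Rel.
- by move=> t; exact/asboolP.
- move=> r s t /asboolP rs /asboolP st; apply/asboolP => x.
  exact: le_trans (st x) (rs x).
- move=> [s ps] [t pt] /asboolP/= st /asboolP/= ts; apply: eq_exist.
  by apply/funext => x; apply/eqP; rewrite eq_le st ts.
- move=> A Atot; have [A0|/set0P[s0 As0]] := eqVneq A set0.
    by exists (exist _ p (conj sp (fun x => lexx (p x)))) => s; rewrite A0.
  pose S x := [set sval s x | s in A].
  have S0 x : S x !=set0 by exists (sval s0 x), s0.
  have lbS x : has_lbound (S x).
    exists (- p (- x)) => _ [[s [ss sp']] As <-] /=.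
    by rewrite (le_trans _ (sublinear_ge x ss))// lerN2.
  pose m x := inf (S x).
  have m_le s x : A s -> m x <= sval s x.
    by move=> As; apply: ge_inf => //; exists s.
  have le_m x z : (forall s, A s -> z <= sval s x) -> z <= m x.
    by move=> zP; apply: lb_le_inf => // _ [s As <-]; exact: zP.
  have sm : sublinear m.
    split=> [x y|r x r0].
      rewrite -lerBlDr; apply: (le_m) => s As.
      rewrite lerBlDr [leRHS]addrC -lerBlDr.
      apply: (le_m) => t At; rewrite lerBlDr [leRHS]addrC.
      (* The pointwise infimum is subadditive because the smaller of the two members of the chain
         can be used at both points. *)
      have [/asboolP st|/asboolP ts] := Atot _ _ As At.
        rewrite (le_trans (m_le t _ At))// (le_trans ((svalP t).1.1 _ _))//.
        by rewrite lerD2r st.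
      rewrite (le_trans (m_le s _ As))// (le_trans ((svalP s).1.1 _ _))//.
      by rewrite lerD2l ts.
    move: r0; rewrite le_eqVlt => /predU1P[<-|r0].
      rewrite scale0r mul0r (le_trans (m_le s0 _ As0))//.
      by rewrite (sublinear0 (svalP s0).1).
    rewrite mulrC -ler_pdivrMr//; apply: (le_m) => s As.
    rewrite ler_pdivrMr// mulrC (le_trans (m_le s _ As))//.
    by apply: (svalP s).1.2; exact: ltW.
  have mp x : m x <= p x by rewrite (le_trans (m_le s0 _ As0))// (svalP s0).2.
  by exists (exist _ m (conj sm mp)) => s As; apply/asboolP => x; exact: m_le.
exists q; split=> // q' sq' q'q.
have q'p x : q' x <= p x by rewrite (le_trans (q'q x)).
by have /(congr1 sval) := qmin (exist _ q' (conj sq' q'p)) (asboolT q'q).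
Qed.

(** A minimal sublinear [q] is odd: restricting it by [[set x]] at level [q x] cannot lower it,
    which gives [q (- x) <= - q x]. An odd sublinear functional is linear. *)
Lemma sublinear_scalar p : sublinear p ->
  exists2 h, scalar h & forall x, h x <= p x.
Proof.
move=> /minimal_sublinear[q [sq qp qmin]]; exists q => //.
have qN x : q (- x) = - q x.
  apply/eqP; rewrite eq_le [X in _ && X]lerNl sublinear_ge// andbT.
  have [||u ->//|q' [sq' q'q q'x _]] := @sublinear_restrict q [set x] (q x) sq.
  - by exists x.
  - exact: convex_set1.
  by rewrite -{1}(qmin _ sq' q'q); exact: q'x.
have qD x y : q (x + y) = q x + q y.
  apply/eqP; rewrite eq_le sq.1/= -lerBrDr -qN.
  by rewrite (le_trans _ (sq.1 _ _))// addrK.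
move=> r x y; rewrite qD; congr +%R.
have [r0|r0] := leP 0 r; first exact: sublinearZ.
rewrite -[r in LHS]opprK scaleNr qN sublinearZ ?mulNr ?opprK//.
by rewrite oppr_ge0 ltW.
Qed.

(** A first restriction yields [p], which dominates every admissible functional and below which all
    linear functionals are admissible. A second one, at [- x] with level [p (- x)], forces
    [h x <= - p (- x)], a lower bound for all [h' x]. *)
Lemma scalar_min q D c x : sublinear q -> D !=set0 -> @convex_set R E D ->
  (forall u, D u -> c <= q u) ->
  exists h, [/\ scalar h, forall y, h y <= q y, forall u, D u -> c <= h u &
    forall h', scalar h' -> (forall y, h' y <= q y) ->
      (forall u, D u -> c <= h' u) -> h x <= h' x].
Proof.
move=> sq D0 cD cq.
have [p [sp pq pD maxp]] := sublinear_restrict sq D0 cD cq.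
have [||u ->//|p' [sp' p'p p'x _]] :=
  @sublinear_restrict p [set - x] (p (- x)) sp.
- by exists (- x).
- exact: convex_set1.
have [h hL hp'] := sublinear_scalar sp'; exists h.
have hN h' y : scalar h' -> h' (- y) = - h' y.
  by move=> h'L; rewrite -scaleN1r scalar_scale// mulN1r.
split=> // [y|u Du|h' h'L h'q h'D].
- by rewrite (le_trans (hp' y))// (le_trans (p'p y)).
- by rewrite -lerN2 -hN// (le_trans (hp' _))// (le_trans (p'p _))// pD.
have := maxp _ h'L h'q h'D (- x); rewrite hN// lerNl; apply: le_trans.
rewrite (le_trans (hp' _))//; have := p'x _ erefl; by rewrite opprK.
Qed.

End hahn_banach.

(** * Functionals of norm at most one *)

Section complex_scalars.
Local Open Scope complex_scope.
Context {R : realType}.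
Implicit Types (z w : R[i]) (r : R).

Lemma Re_le_norm z : complex.Re z <= complex.Re `|z|.
Proof.
rewrite -lecR RRe_real ?normr_real//; apply: le_trans (normc_ge_Re z).
by rewrite lecR ler_norm.
Qed.

Lemma Re_le z w : z <= w -> complex.Re z <= complex.Re w.
Proof. by rewrite lecE => /andP[]. Qed.

Lemma norm_le1_Re z : `|z| <= 1 -> complex.Re z <= 1.
Proof. by move=> /Re_le; apply: le_trans; exact: Re_le_norm. Qed.

(** The squares of the real and imaginary parts add up to at most 1, and the first is already 1. *)
Lemma norm_le1_eq1 z : `|z| <= 1 -> complex.Re z = 1 -> z = 1.
Proof.
move=> z1 Rez; have : ((complex.Re z) ^+ 2 + (complex.Im z) ^+ 2)%:C <= 1%:C.
  by rewrite add_Re2_Im2 expr_le1.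
rewrite lecR Rez expr1n gerDl => Imz.
have /eqP : complex.Im z ^+ 2 = 0 by apply/eqP; rewrite eq_le Imz sqr_ge0.
by rewrite sqrf_eq0 => /eqP Im0; case: z Rez Im0 {z1 Imz} => a b /= -> ->.
Qed.

Lemma ReB z w : complex.Re (z - w) = complex.Re z - complex.Re w.
Proof. by case: z w => a b []. Qed.

Lemma ReD z w : complex.Re (z + w) = complex.Re z + complex.Re w.
Proof. by case: z w => a b []. Qed.

Lemma ReN z : complex.Re (- z) = - complex.Re z.
Proof. by case: z. Qed.

Lemma Re_realM r z : complex.Re (r%:C * z) = r * complex.Re z.
Proof. by case: z => a b /=; rewrite mul0r subr0. Qed.

(** Weights comparable with 0 are real, so taking real parts gives a convex combination in [R]. *)
Lemma Re_comb_eq_max r (s t : R[i]) z w : 0 < s -> 0 <= t -> s + t = 1 ->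
  complex.Re z <= r -> complex.Re w <= r -> r <= complex.Re (s * z + t * w) ->
  complex.Re z = r.
Proof.
move=> s0 t0 st zr wr.
have sE : s = (complex.Re s)%:C by rewrite RRe_real// gtr0_real.
have tE : t = (complex.Re t)%:C by rewrite RRe_real// ger0_real.
move: s0 t0 st; rewrite sE tE ReD !Re_realM ltcR ler0c -rmorphD => s0 t0 [st].
exact: convex_comb_eq_max.
Qed.

Lemma closed_lipschitz (k : R[i] -> R) r :
  (forall z w, `|k z - k w|%:C <= `|z - w|) -> closed [set z : R[i]^o | k z <= r].
Proof.
move=> kL; rewrite -[X in closed X]setCK; apply: open_closedC.
rewrite openE => z /= /negP; rewrite -ltNge => rz.
apply/nbhs_ballP; exists (k z - r)%:C => /=; first by rewrite ltcR subr_gt0.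
move=> w; rewrite /ball/= => zw; apply/negP; rewrite -ltNge.
have := le_lt_trans (kL z w) zw; rewrite ltcR => /(le_lt_trans (ler_norm _)).
by rewrite ltrD2l ltrN2.
Qed.

Lemma closed_Re_le r : closed [set z : R[i]^o | complex.Re z <= r].
Proof. by apply: closed_lipschitz => z w; rewrite -ReB normc_ge_Re. Qed.

Lemma closed_norm_le1 : closed [set z : R[i]^o | `|z| <= 1].
Proof.
have : closed [set z : R[i]^o | complex.Re `|z| <= 1].
  apply: (@closed_lipschitz (fun z => complex.Re `|z|)) => z w.
  rewrite -ReB (le_trans (normc_ge_Re _))//; exact: ler_dist_dist.
rewrite (_ : [set z | _] = [set z | `|z| <= 1])//; apply/seteqP; split=> z.
  by rewrite /mkset -lecR RRe_real ?normr_real.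
by move=> /Re_le.
Qed.

End complex_scalars.

(** An alias that carries the module structure over [R], so that the real Hahn-Banach argument
    applies to a complex space. *)
Definition real_restriction {R : realType} (X : lmodType R[i]) : Type := X.

Section real_restriction.
Local Open Scope complex_scope.
Context {R : realType} (X : lmodType R[i]).

HB.instance Definition _ := GRing.Zmodule.copy (real_restriction X) X.

Definition real_scale (r : R) (x : real_restriction X) : real_restriction X :=
  r%:C *: (x : X).

Lemma real_scaleA r s x : real_scale r (real_scale s x) = real_scale (r * s) x.
Proof. by rewrite /real_scale scalerA rmorphM. Qed.

Lemma real_scale1 : left_id 1 real_scale.
Proof. by move=> x; rewrite /real_scale scale1r. Qed.

Lemma real_scaleDr : right_distributive real_scale +%R.
Proof. by move=> r x y; rewrite /real_scale scalerDr. Qed.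

Lemma real_scaleDl x : {morph real_scale^~ x : r s / r + s}.
Proof. by move=> r s; rewrite /real_scale rmorphD scalerDl. Qed.

HB.instance Definition _ := GRing.Zmodule_isLmodule.Build R (real_restriction X)
  real_scaleA real_scale1 real_scaleDr real_scaleDl.

Lemma convex_real_restriction (C : set X) : @convex_set R[i] X C ->
  @convex_set R (real_restriction X) C.
Proof.
move=> /convex_setE cC; apply/convex_setE => x y a b a0 b0 ab Cx Cy.
by apply: cC; rewrite ?ler0c// -rmorphD ab.
Qed.

End real_restriction.

Section dual_ball.
Local Open Scope complex_scope.
Context {R : realType} {X : normedModType R[i]}.
Implicit Types (a b : dual X) (x : X) (F : set X).

Lemma dual_linear a : linear a.
Proof. by have := dual_funP a; rewrite inE => -[]. Qed.

HB.instance Definition _ a :=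
  GRing.isLinear.Build R[i] X R[i]^o *:%R (dual_fun a) (dual_linear a).

Lemma dual_continuous a : continuous (a : X -> R[i]^o).
Proof. by have := dual_funP a; rewrite inE => -[]. Qed.

(** Continuity bounds the set of values in [dual_norm], so its [sup] really is an upper bound. *)
Lemma dual_unit_ballP a :
  dual_unit_ball X a <-> forall x, `|x| <= 1 -> `|a x| <= 1.
Proof.
split=> [a1 x x1|a1].
  rewrite -[leLHS]RRe_real ?normr_real// (_ : 1 = 1%:C)// lecR.
  apply: le_trans a1; apply: ub_le_sup; last by exists x.
  have /linear_boundedP/pinfty_ex_gt0[r r0 ar] :=
    @continuous_linear_bounded _ _ _ 0 a (@dual_continuous a 0).
  exists (complex.Re r) => _ [y y1 <-]; apply: Re_le.
  by rewrite (le_trans (ar y))// ler_piMr// ltW.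
apply: ge_sup.
  by exists (complex.Re `|a 0|), 0; rewrite //= /unit_ball/= normr0.
move=> _ [x x1 <-]; exact: (Re_le (a1 x x1)).
Qed.

Lemma dual_Re_le a x : dual_unit_ball X a -> complex.Re (a x) <= complex.Re `|x|.
Proof.
move=> /dual_unit_ballP a1; apply: le_trans (Re_le_norm _) _; apply: Re_le.
have [->|x0] := eqVneq x 0; first by rewrite linear0 !normr0.
have := a1 (`|x|^-1 *: x); rewrite normrZ normfV normr_id mulVf ?normr_eq0//.
move=> /(_ (lexx _)); rewrite linearZ/= normrZ normfV normr_id.
by rewrite ler_pdivrMl ?normr_gt0// mulr1.
Qed.

(** A complex functional is determined by its real part: [a x] has to be [h x] minus ['i] times
    [h ('i *: x)]. *)
Lemma exists_dual_Re (h : real_restriction X -> R) : scalar h ->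
  (forall x : X, h x <= complex.Re `|x|) ->
  exists2 a : dual X, dual_unit_ball X a & forall x, complex.Re (a x) = h x.
Proof.
move=> hL h1.
have hD (x y : X) : h (x + y) = h x + h y by exact: (scalarD _ _ hL).
have hZ (r : R) (x : X) : h (r%:C *: x) = r * h x by exact: (scalar_scale _ _ hL).
pose A (x : X) : R[i]^o := h x -i* h ('i *: x).
have i2 (x : X) : 'i *: ('i *: x) = - x.
  by rewrite scalerA -expr2 sqr_i scaleN1r.
have hN (x : X) : h (- x) = - h x.
  by rewrite -scaleN1r -[-1 in LHS](rmorphN1 (real_complex R)) hZ mulN1r.
have AL : linear A.
  move=> [c d] x y.
  have zE (v : X) : (c +i* d) *: v = c%:C *: v + d%:C *: ('i *: v).
    by rewrite scalerA -scalerDl; congr (_ *: _); simpc.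
  have -> : A ((c +i* d) *: x + y) = (c * h x + d * h ('i *: x) + h y)
      -i* (c * h ('i *: x) - d * h x + h ('i *: y)).
    rewrite /A scalerDr scalerA [_ * (_ +i* _)]mulrC -scalerA !zE i2.
    by rewrite !hD !hZ hN mulrN.
  by rewrite /A /GRing.scale/=; simpc; congr Complex; ring.
pose Al : {linear X -> R[i]^o} := HB.pack A (GRing.isLinear.Build _ _ _ _ A AL).
have A1 (x : X) : `|Al x| <= `|x|.
  have [->|Ax0] := eqVneq (Al x) 0; first by rewrite normr0.
  (* Rotating [x] by the unimodular [t] makes the value of [Al] real and nonnegative, where the
     bound on [h] controls it. *)
  pose t := `|Al x| / Al x.
  have t1 : `|t| = 1 by rewrite normrM normfV normr_id divff// normr_eq0.
  have AtE : Al (t *: x) = `|Al x| by rewrite linearZ; exact: divfK.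
  have := h1 (t *: x); rewrite normrZ t1 mul1r.
  rewrite -[h _]/(complex.Re (Al (t *: x))) AtE -lecR.
  by rewrite !RRe_real ?normr_real.
have Ac : continuous (Al : X -> R[i]^o).
  apply/bounded_linear_continuous/linear_boundedP; near=> r => x.
  rewrite (le_trans (A1 x))// ler_peMl//; near: r; exact: nbhs_pinfty_ge.
have Adual : A \in continuous_linear (X := X) by rewrite inE.
exists (Dual Adual) => //; apply/dual_unit_ballP => x x1.
exact: le_trans (A1 x) x1.
Unshelve. all: by end_near.
Qed.

End dual_ball.

(** * Closed faces as intersections of facets *)

Section exposed_faces.
Local Open Scope complex_scope.
Context {R : realType} {X : normedModType R[i]}.
Implicit Types (a b : dual X) (x y : X) (F G : set X).

Lemma norm_sublinear :
  sublinear (fun x : real_restriction X => complex.Re `|x : X|).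
Proof.
split=> [x y|r x r0].
  by have := Re_le (ler_normD (x : X) y); rewrite ReD.
by rewrite -[r *: x]/(r%:C *: (x : X)) normrZ ger0_norm ?ler0c// Re_realM.
Qed.

Definition min_face F x : set (dual X) :=
  [set b | upper_prime F b /\
    forall a, upper_prime F a -> complex.Re (b x) <= complex.Re (a x)].

(** The real functionals below the norm and at least 1 on [F] are the real parts of the members of
    [upper_prime F], so [scalar_min] with level 1 provides a minimiser. *)
Lemma min_face_nonempty F x : F `<=` unit_sphere X -> F !=set0 ->
  @convex_set R[i] X F -> min_face F x !=set0.
Proof.
move=> FS F0 cF.
have [|h [hL h1 hF hmin]] := scalar_min (x : real_restriction X) norm_sublinear
  F0 (convex_real_restriction cF) (c := 1).
  by move=> u /FS ->.
have [b b1 bE] := exists_dual_Re hL h1.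
exists b; split=> [|a [a1 aF]].
  split=> // u Fu; apply: norm_le1_eq1.
    by move/dual_unit_ballP : b1; apply; rewrite (FS _ Fu).
  apply/eqP; rewrite eq_le bE hF// andbT -(bE u).
  by rewrite (le_trans (dual_Re_le u b1))// (FS _ Fu).
rewrite bE; apply: (hmin (fun y => complex.Re (a y))).
- move=> r u v; have -> : a (r *: u + v) = r%:C * a u + a v by exact: dual_linear.
  by rewrite ReD Re_realM.
- by move=> y; exact: dual_Re_le.
- by move=> u Fu; rewrite aF.
Qed.

Lemma dual_combE a b x (s t : R[i]) : (s *: a + t *: b) x = s * a x + t * b x.
Proof. by []. Qed.

Lemma convex_dual_unit_ball : @convex_set R[i] (dual X) (dual_unit_ball X).
Proof.
apply/convex_setE => a b s t s0 t0 st /dual_unit_ballP a1 /dual_unit_ballP b1.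
apply/dual_unit_ballP => x x1; rewrite dual_combE.
rewrite (le_trans (ler_normD _ _))// !normrM (ger0_norm s0) (ger0_norm t0) -st.
by rewrite lerD// ler_piMr// ?a1// b1.
Qed.

(** On [F] both functionals have real part at most 1 while their combination equals 1. *)
Lemma upper_prime_comb F a b (s t : R[i]) : F `<=` unit_sphere X ->
  0 < s -> 0 <= t -> s + t = 1 -> dual_unit_ball X a -> dual_unit_ball X b ->
  upper_prime F (s *: a + t *: b) -> upper_prime F a.
Proof.
move=> FS s0 t0 st a1 b1 [_ abF]; split=> // u Fu.
have u1 : complex.Re `|u| = 1 by rewrite (FS _ Fu).
apply: norm_le1_eq1.
  by move/dual_unit_ballP : a1; apply; rewrite (FS _ Fu).
have := abF _ Fu; rewrite dual_combE => abu.
apply: (Re_comb_eq_max s0 t0 st (w := b u)).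
- by rewrite -u1; exact: dual_Re_le.
- by rewrite -u1; exact: (dual_Re_le _ b1).
- by rewrite abu.
Qed.

Lemma min_face_is_face F x : F `<=` unit_sphere X ->
  is_face (dual_unit_ball X) (min_face F x).
Proof.
move=> FS; apply: is_faceE => [b [[]]//| |a b s t s0 t0 st a1 b1 [abF abmin]].
  apply/convex_setE => a b s t s0 t0 st [[a1 aF] amin] [[b1 bF] bmin].
  split=> [|c cF].
    split; first by move/convex_setE : convex_dual_unit_ball; apply.
    by move=> u Fu; rewrite dual_combE aF// bF// !mulr1.
  rewrite dual_combE.
  have sE : s = (complex.Re s)%:C by rewrite RRe_real// ger0_real.
  have tE : t = (complex.Re t)%:C by rewrite RRe_real// ger0_real.
  move: s0 t0 st; rewrite sE tE ReD !Re_realM !ler0c -rmorphD => s0 t0 [st].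
  rewrite -[leRHS]mul1r -st mulrDl lerD// ler_wpM2l//; [exact: amin|exact: bmin].
have aF := upper_prime_comb FS s0 (ltW t0) st a1 b1 abF.
have bF : upper_prime F b.
  by apply: (upper_prime_comb FS t0 (ltW s0) _ b1 a1); rewrite addrC.
split=> // c cF; apply: le_trans (abmin c cF).
suff -> : complex.Re (a x) = complex.Re ((s *: a + t *: b) x) by [].
(* Negation turns the minimum at [x] into a maximum, as [Re_comb_eq_max] requires. *)
apply: oppr_inj; rewrite -!ReN.
apply: (Re_comb_eq_max s0 (ltW t0) st (w := - b x)).
- by rewrite !ReN lerN2 abmin.
- by rewrite !ReN lerN2 abmin.
- by rewrite dual_combE !mulrN -opprD.
Qed.

Lemma weak_star_eval x : continuous (fun a : weak_star X => a x : R[i]^o).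
Proof.
move=> a; have := @continuous_comp _ _ _
  (@dual_fun R X : weak_star X -> {ptws X -> R[i]^o})
  (@proj X (fun=> R[i]^o) x : {ptws X -> R[i]^o} -> R[i]^o) a.
by apply; [exact: initial_continuous|exact: proj_continuous].
Qed.

Lemma min_face_closed F x : closed (min_face F x : set (weak_star X)).
Proof.
(* Every condition becomes a closed condition on one evaluation, and evaluations are weak*
   continuous. *)
have -> : min_face F x =
    \bigcap_(y in unit_ball X) [set a | `|a y| <= 1] `&`
    \bigcap_(u in F) [set a | a u = 1] `&`
    \bigcap_(c in upper_prime F) [set a | complex.Re (a x) <= complex.Re (c x)].
  apply/seteqP; split=> [a [[/dual_unit_ballP a1 aF] amin]|a [[a1 aF] amin]].
    by split=> [|c]; [split=> [y|u]; [exact: a1|exact: aF]|exact: amin].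
  by split=> [|c]; [split=> [|u]; [exact/dual_unit_ballP|exact: aF]|exact: amin].
have closed_eval y (Z : set R[i]^o) : closed Z ->
    closed [set a : weak_star X | Z (a y)].
  by move=> cZ; apply: closed_comp cZ => a _; exact: weak_star_eval.
apply: closedI; first apply: closedI.
- apply: closed_bigI => y _; apply: (closed_eval y [set z | `|z| <= 1]).
  exact: closed_norm_le1.
- apply: closed_bigI => u _; apply: (closed_eval u [set 1]).
  exact: (accessible_closed_set1 (hausdorff_accessible _)).
- apply: closed_bigI => c _; apply: (closed_eval x [set z | complex.Re z <= _]).
  exact: closed_Re_le.
Qed.

Lemma min_face_proper F x : F !=set0 -> min_face F x <> dual_unit_ball X.
Proof.
move=> [u Fu] FE; have : dual_unit_ball X (0 : dual X).
  by apply/dual_unit_ballP => y _; rewrite -[(0 : dual X) y]/0 normr0.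
rewrite -FE => -[[_ /(_ u Fu)/esym/eqP]].
by rewrite -[(0 : dual X) u]/0 oner_eq0.
Qed.

Lemma facet_separation F x : weak_star_closed_proper_faces_semi_exposed X ->
  norm_semi_exposed F -> F `<=` unit_sphere X -> F !=set0 ->
  @convex_set R[i] X F -> unit_ball X x -> ~ F x ->
  exists M, [/\ facet M, F `<=` M & ~ M x].
Proof.
move=> X2 FE FS F0 cF x1 Fx.
have mE : weak_star_semi_exposed (min_face F x).
  apply: X2; split; [exact: min_face_closed|exact: min_face_is_face|].
  exact: min_face_proper.
set G := lower_prime (min_face F x).
have [b [bF bmin]] := min_face_nonempty x FS F0 cF.
(* As [F] is semi-exposed and misses [x], some [a] in [upper_prime F] has [a x <> 1]; the minimiser
   [b] does at least as well. *)
have bx : complex.Re (b x) < 1.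
  have [a [aF ax]] : exists a, upper_prime F a /\ a x <> 1.
    apply: contrapT => nF; apply: Fx; rewrite FE; split=> // a aF.
    by apply: contrapT => ax; apply: nF; exists a.
  apply: le_lt_trans (bmin a aF) _; have [a1 _] := aF.
  have ax1 : `|a x| <= 1 by move/dual_unit_ballP : a1; exact.
  rewrite lt_neqAle norm_le1_Re// andbT; apply/eqP => /norm_le1_eq1.
  by move=> /(_ ax1).
(* The functional [b] lies in the dual ball and equals 1 on [G]. *)
have GS : G `<=` unit_sphere X.
  move=> y [y1 yG]; apply/eqP; rewrite eq_le y1/=.
  rewrite -[`|y|]RRe_real ?normr_real// (_ : 1 = 1%:C)// lecR.
  have [b1 _] := bF; apply: le_trans (dual_Re_le y b1).
  by rewrite yG.
have cG : @convex_set R[i] X G.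
  apply/convex_setE => y z s t s0 t0 st [y1 yG] [z1 zG]; split.
    rewrite /unit_ball/= (le_trans (norm_convex_le _ _ s0 t0))// -st.
    by rewrite lerD// ler_piMr.
  move=> a aG; have -> : a (s *: y + t *: z) = s * a y + t * a z.
    by rewrite linearD !linearZ.
  by rewrite yG// zG// !mulr1.
have FG : F `<=` G.
  move=> u Fu; split=> [|a [[_ aF] _]]; last exact: aF.
  by rewrite /unit_ball/= (FS _ Fu).
have [M fM GM] := exists_facet GS cG; have [MS cM _] := fM.
exists M; split=> //; first exact: subset_trans GM.
(* A functional [c] equal to 1 on [M] is 1 on [G], so semi-exposedness puts it in [min_face F x].
   Minimality gives real part at most that of [b x], below 1, against [c x = 1]. *)
move=> Mx; have [|c [[c1 cM1] _]] := min_face_nonempty x MS _ cM.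
  by exists x.
have : min_face F x c by rewrite mE; split=> // y Gy; apply: cM1; exact: GM.
by move=> [_ /(_ b bF)]; rewrite (cM1 _ Mx) leNgt bx.
Qed.

Lemma semi_exposed_bigcap_facets F :
  weak_star_closed_proper_faces_semi_exposed X ->
  norm_semi_exposed F -> F `<=` unit_sphere X -> F !=set0 ->
  @convex_set R[i] X F ->
  F = \bigcap_(M in [set M | facet M /\ F `<=` M]) M.
Proof.
move=> X2 FE FS F0 cF; apply/seteqP; split=> [x Fx M [_]|x xM]; first exact.
(* At least one facet contains [F], which keeps the intersection inside the sphere. *)
have [M0 fM0 FM0] := exists_facet FS cF; have [M0S _ _] := fM0.
apply: contrapT => Fx.
have [|M [fM FM]] := facet_separation X2 FE FS F0 cF _ Fx; last first.
  by apply; exact: xM.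
by rewrite /unit_ball/= (M0S x)//; exact: xM.
Qed.

End exposed_faces.

(** * Transfer of closed faces along the isometry *)

Lemma sphere_isometry_closed_face (R : realType) (X Y : normedModType R[i])
    (f : X -> Y) (F : set X) : closed_faces_semi_exposed X ->
  weak_star_closed_proper_faces_semi_exposed X -> surjective_sphere_isometry f ->
  F `<=` unit_sphere X -> norm_closed_face F -> norm_closed_face (f @` F).
Proof.
move=> X1 X2 f_iso FS cfF; have [_ [_ cF _]] := cfF.
have [->|/set0P F0] := eqVneq F set0.
  rewrite image_set0; split; first exact: closed0.
  by split=> //; apply/convex_setE.
have [M0 fM0 FM0] := exists_facet FS cF.
pose D := [set M | facet M /\ F `<=` M].
have D0 : D M0 by [].
(* The image commutes with this nonempty intersection because [f] is injective on the sphere. *)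
have -> : f @` F = \bigcap_(M in D) (f @` M).
  rewrite [in LHS](semi_exposed_bigcap_facets X2 (X1 _ cfF) FS F0 cF).
  apply/seteqP; split=> [_ [x xM <-] M DM|y yM].
    by exists x => //; exact: xM.
  have [x M0x xy] := yM _ D0; exists x => // M DM.
  have [z Mz zy] := yM _ DM; have [[MS _ _] _] := DM; have [M0S _ _] := fM0.
  by rewrite (sphere_isometry_inj f_iso (M0S _ M0x) (MS _ Mz))// zy.
split.
  apply: closed_bigI => M [fM _]; apply: facet_closed.
  exact: sphere_isometry_facet.
apply: is_face_bigcap; first by exists M0.
by move=> M [fM _]; apply/facet_face/sphere_isometry_facet.
Qed.

Theorem corollary2p5 (R : realType) (X Y : completeNormedModType R[i])
  (X1 : closed_faces_semi_exposed X)
  (Y1 : closed_faces_semi_exposed Y)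
  (X2 : weak_star_closed_proper_faces_semi_exposed X)
  (Y2 : weak_star_closed_proper_faces_semi_exposed Y)
  (f : X -> Y) (f_iso : surjective_sphere_isometry f) :
  (forall F : set X, F `<=` unit_sphere X -> @convex_set R[i] X F ->
     (norm_closed_face F <-> norm_closed_face (f @` F)))
  /\
  (forall e : X, unit_sphere X e ->
     (extreme_points (unit_ball X) e <->
      extreme_points (unit_ball Y) (f e))).
Proof.
have [g [g_iso gf]] := sphere_isometry_inv f_iso.
have faces (F : set X) : F `<=` unit_sphere X ->
    norm_closed_face F <-> norm_closed_face (f @` F).
  move=> FS; split; first exact: sphere_isometry_closed_face.
  have fFS : f @` F `<=` unit_sphere Y.
    by move=> _ [x /FS x1 <-]; case: f_iso => fS _ _; exact: fS.
  (* The converse is the forward implication for the inverse isometry [g], under the hypotheses on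
     [Y]. *)
  have {2}-> : F = g @` (f @` F).
    rewrite image_comp; apply/seteqP; split=> [x Fx|_ [x Fx <-]].
      by exists x => //=; rewrite gf//; exact: FS.
    by rewrite /= gf//; exact: FS.
  exact: sphere_isometry_closed_face.
(* Extreme points are the closed faces with one element, so the second claim is the first for
   singletons. *)
have extremeE (Z : normedModType R[i]) (e : Z) :
    extreme_points (unit_ball Z) e <-> norm_closed_face [set e].
  rewrite extreme_pointsE; split=> [|[]//]; split=> //.
  exact: (accessible_closed_set1 (hausdorff_accessible (@norm_hausdorff _ _))).
split=> [F FS _|e e1]; first exact: faces.
rewrite !extremeE faces ?image_set1//.
by move=> _ ->.
Qed.
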